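(* For each positive integer $n$, let $T$ be a standard Young tableau of the shifted staircase shape $(2n-1,2n-3,\ldots,3,1)$ chosen uniformly at random among all such tableaux, and let $S\in\{0,1,\ldots,n-1\}$ be the integer such that the cell $(n-S,\,n+S)$ of $T$ contains the maximal label $n^2$. Then for all $0\le a\le b\le 1$, \[ \lim_{n\to\infty}\Pr\!\left(a\le \frac{S}{n}\le b\right)=\int_a^b \frac{4}{\pi}\sqrt{1-x^2}\,dx . \]
   Context: For a strict partition $\lambda=(\lambda_1>\lambda_2>\cdots>\lambda_k>0)$, the shifted Young diagram of shape $\lambda$ is the set of cells $(i,j)\in\mathbb{Z}^2$ with $1\le i\le k$ and $i\le j<\lambda_i+i$. A standard Young tableau of shifted shape $\lambda$ is a bijective filling of these cells with $1,2,\ldots,|\lambda|$ that increases from left to right along each row and from top to bottom along each column (i.e. the label of $(i,j)$ is smaller than those of $(i,j+1)$ and $(i+1,j)$ whenever these are cells). For the shape $(2n-1,2n-3,\ldots,3,1)$, the cells are $(i,j)$ with $1\le i\le n$, $i\le j\le 2n-i$, there are $n^2$ cells, and the maximal label $n^2$ necessarily lies in a cell of the form $(n-r,n+r)$ with $0\le r\le n-1$. *)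

(* Defs.v *)
From HB Require Import structures.
From mathcomp Require Import all_boot all_order all_algebra.
From mathcomp Require Import all_classical all_reals all_analysis.
From mathcomp Require Import zify.
Set Implicit Arguments.
Unset Strict Implicit.
Unset Printing Implicit Defensive.
Import Order.TTheory GRing.Theory Num.Theory.

Local Open Scope nat_scope.

(* Cells are 1-indexed pairs (row, column), as in the matrix convention; the
   row i of the diagram has lambda_i = nth 0 lam i.-1 cells, starting on the
   diagonal. *)
Definition shifted_diagram (lam : seq nat) : seq (nat * nat) :=
  [seq (i, j) | i <- iota 1 (size lam), j <- iota i (nth 0 lam i.-1)].

Definition cell (lam : seq nat) : finType := seq_sub (shifted_diagram lam).

Definition filling (lam : seq nat) : finType :=
  {ffun cell lam -> 'I_(sumn lam)}.

(* The labels are 1, ..., |lambda|, whereas 'I_|lambda| starts at 0. *)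
Definition label (lam : seq nat) (T : filling lam) (c : cell lam) : nat :=
  (T c).+1.

Definition right_of (c d : nat * nat) : bool := d == (c.1, c.2.+1).
Definition below (c d : nat * nat) : bool := d == (c.1.+1, c.2).

Definition is_standard (lam : seq nat) (T : filling lam) : bool :=
  [&& injectiveb T,
      [forall k, exists c, T c == k]
    & [forall c, forall d,
         right_of (val c) (val d) || below (val c) (val d) ==>
         (label T c < label T d)]].

Definition SYT (lam : seq nat) : {set filling lam} :=
  [set T | is_standard T].

(* The shape (2n-1, 2n-3, ..., 3, 1). *)
Definition staircase (n : nat) : seq nat := mkseq (fun i => 2 * (n - i) - 1) n.

Definition max_label_at (n : nat) (T : filling (staircase n)) (r : nat) : bool :=
  [exists c, (val c == (n - r, n + r)) && (label T c == n ^ 2)].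

(* The default value 0 is never used on standard tableaux with n > 0: see
   max_label_posP. *)
Definition max_label_pos (n : nat) (T : filling (staircase n)) : nat :=
  if [pick r : 'I_n | max_label_at T r] is Some r then val r else 0.

Definition uniform_pr (R : realType) (X : finType) (A : {set X})
    (E : pred X) : R :=
  (#|[set x in A | E x]|%:R / #|A|%:R)%R.

Lemma mem_shifted_diagram (lam : seq nat) (i j : nat) :
  ((i, j) \in shifted_diagram lam) =
  (1 <= i <= size lam) && (i <= j < nth 0 lam i.-1 + i).
Proof.
apply/allpairsPdep/idP => [[x [y []]]|].
  by rewrite !mem_iota => ? ? [-> ->]; lia.
by move=> ?; exists i, j; rewrite !mem_iota; split=> //; lia.
Qed.

Lemma mem_staircase_diagram (n i j : nat) :
  ((i, j) \in shifted_diagram (staircase n)) =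
  (1 <= i <= n) && (i <= j <= 2 * n - i).
Proof.
rewrite mem_shifted_diagram size_mkseq.
case: (boolP (1 <= i <= n)) => //= ni.
by rewrite nth_mkseq; lia.
Qed.

Lemma sumn_staircase (n : nat) : sumn (staircase n) = n ^ 2.
Proof.
elim: n => // n IHn.
have -> : staircase n.+1 = (2 * n.+1 - 1) :: staircase n.
  rewrite /staircase /mkseq /= subn0; congr cons.
  by rewrite -[1]addn0 iotaDl -map_comp.
by rewrite /= IHn -!mulnn; lia.
Qed.

Lemma max_label_posP (n : nat) (T : filling (staircase n)) :
  0 < n -> T \in SYT (staircase n) ->
  (max_label_pos T < n) && max_label_at T (max_label_pos T).
Proof.
move=> n0; rewrite inE => /and3P[_ /forallP sT /forallP mT].
rewrite /max_label_pos; case: pickP => [r -> /=|noT]; first by rewrite ltn_ord.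
have n2 : (n ^ 2).-1 < sumn (staircase n)
  by rewrite sumn_staircase prednK // expn_gt0 n0.
have /existsP[c /eqP Tc] := sT (Ordinal n2).
have lc : label T c = n ^ 2 by rewrite /label Tc /= prednK // expn_gt0 n0.
case ec : (val c) (valP c) => [i j] /=; rewrite mem_staircase_diagram => cP.
have [ej|nj] := eqVneq j (2 * n - i).
  have rn : n - i < n by lia.
  have /negP[] := negbT (noT (Ordinal rn)).
  by apply/existsP; exists c; rewrite ec lc eqxx andbT /= xpair_eqE; lia.
have dP : (i, j.+1) \in shifted_diagram (staircase n).
  by rewrite mem_staircase_diagram; lia.
have := forallP (mT c) (SeqSub dP).
rewrite ec /right_of eqxx /= lc /label => Td.
have := ltn_ord (T (SeqSub dP)).
by rewrite [X in _ < X]sumn_staircase ltnNge -ltnS Td.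
Qed.

(* Main.v *)
(* Removing the maximal label shows that P(S = r) is the quotient of the numbers
   of tableaux of two shifted shapes, both given by Schur's product formula; that
   formula follows from the recursion over corners and Lagrange interpolation.
   With w_k = \prod_(1 <= i <= k) (2i-1)/(2i) the quotient simplifies to
     P(S = r) = (4r+1) (n-r) w_r^2 w_(n-r) / (n^2 w_(n+r)).
   By monotonicity c/(k+1/2) <= w_k^2 <= c/k for some c > 0, so P(S = r) is
   (4c/n) sqrt(1-(r/n)^2) up to an error whose sum over r is O(1/sqrt n), and the
   distribution function of S/n is a Riemann sum up to O(1/sqrt n).  Since the
   total mass is 1, c = 1/pi, so no separate proof of Wallis' formula is needed. *)
Require Import Defs.
From HB Require Import structures.
From mathcomp Require Import all_boot all_order all_algebra.
From mathcomp Require Import zify ring lra.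
Set Implicit Arguments.
Unset Strict Implicit.
Unset Printing Implicit Defensive.
Import Order.TTheory GRing.Theory Num.Theory.

(** * Counting linear extensions *)

Section LinearExtensions.
Variables (C : finType) (e : rel C) (N : nat) (d : 'I_N).
Local Open Scope nat_scope.
Implicit Types (A : {set C}) (f : {ffun C -> 'I_N}).

(* Linear extensions of [A], extended by the dummy label [d] outside [A]. *)
Definition linext A : {set {ffun C -> 'I_N}} :=
  [set f : {ffun C -> 'I_N} |
   [&& [forall x, if x \in A then f x < #|A| else f x == d],
       [forall x in A, forall y in A, (f x == f y) ==> (x == y)]
     & [forall x in A, forall y in A, e x y ==> (f x < f y)]]].

Lemma linextP A f :
  reflect [/\ forall x, x \in A -> f x < #|A|,
              forall x, x \notin A -> f x = d,
              {in A &, injective f}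
            & {in A &, forall x y, e x y -> f x < f y}]
          (f \in linext A).
Proof.
rewrite inE; apply: (iffP and3P) => [[/forallP H1 H2 H3]|[H1 H2 H3 H4]]; split.
- by move=> x xA; have := H1 x; rewrite xA.
- by move=> x /negPf xA; have := H1 x; rewrite xA => /eqP.
- move=> x y xA yA fxy.
  have /forall_inP/(_ y yA)/implyP := forall_inP H2 x xA.
  by rewrite fxy eqxx => /(_ isT)/eqP.
- move=> x y xA yA exy.
  by have /forall_inP/(_ y yA)/implyP/(_ exy) := forall_inP H3 x xA.
- by apply/forallP => x; case: ifPn => [/H1|/H2/eqP].
- apply/forall_inP => x xA; apply/forall_inP => y yA; apply/implyP => /eqP fxy.
  by apply/eqP/H3.
- apply/forall_inP => x xA; apply/forall_inP => y yA; apply/implyP => exy.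
  exact: H4.
Qed.

(** For a shifted shape and the relation [cover] these are the corners, the cells that can hold the
    largest label. *)
Definition maximal_in A x := [forall y in A, ~~ e x y].

(** Pigeonhole: [f] maps [A] injectively into the [#|A|] labels below [#|A|], hence onto them. *)
Lemma linext_top A f : f \in linext A -> A != set0 ->
  exists2 x, x \in A & f x = #|A|.-1 :> nat.
Proof.
move=> /linextP[fA _ fI _] A0.
have A_gt0 : 0 < #|A| by rewrite card_gt0.
have N_gt : #|A| <= N.
  have := max_card (mem (f @: A)); rewrite card_ord => h.
  by rewrite -(card_in_imset fI).
have/subset_leqif_cards[_] :
    f @: A \subset [set i : 'I_N | i < #|A|].
  by apply/subsetP => _ /imsetP[x xA ->]; rewrite inE fA.
rewrite (card_in_imset fI).
have -> : #|[set i : 'I_N | i < #|A|]| = #|A|.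
  have wI : injective (widen_ord N_gt) by move=> i j [] /val_inj.
  rewrite -[RHS]card_ord -(card_imset predT wI).
  apply: eq_card => i; rewrite inE; apply/idP/imsetP => [iA|[j _ ->]//=].
  by exists (Ordinal iA) => //; apply/val_inj.
rewrite eqxx => /esym/eqP fE.
have lN : #|A|.-1 < N by rewrite prednK.
have : Ordinal lN \in f @: A by rewrite fE inE /= prednK.
by case/imsetP => x xA fx; exists x => //; rewrite -fx.
Qed.

Lemma linext_top_maximal A f x : f \in linext A -> x \in A ->
  f x = #|A|.-1 :> nat -> maximal_in A x.
Proof.
move=> /linextP[fA _ _ fM] xA fx; apply/forall_inP => y yA.
apply/negP => /(fM _ _ xA yA); rewrite fx.
by move=> h; have := fA _ yA; lia.
Qed.

(** Resetting the label of [x] to [d] is a bijection. Its inverse gives [x] the label [#|A|.-1],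
    which respects [e] because [x] is maximal. *)
Lemma card_linext_top A x : #|A| <= N -> x \in A -> maximal_in A x ->
  #|[set f in linext A | f x == #|A|.-1 :> nat]| = #|linext (A :\ x)|.
Proof.
move=> AN xA /forall_inP xmax.
have A_gt0 : 0 < #|A| by rewrite (cardD1 x) xA.
have lN : #|A|.-1 < N by rewrite prednK.
have AxE : #|A :\ x| = #|A|.-1 by rewrite (cardsD1 x A) xA.
pose g (f : {ffun C -> 'I_N}) : {ffun C -> 'I_N} :=
  [ffun y => if y == x then d else f y].
have gI : {in [set f in linext A | f x == #|A|.-1 :> nat] &, injective g}.
  move=> f h; rewrite !inE => /andP[_ /eqP fx] /andP[_ /eqP hx] /ffunP gfh.
  apply/ffunP => y; have := gfh y; rewrite !ffunE.
  by case: eqP => [->|//] _; apply/val_inj; rewrite /= fx hx.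
rewrite -(card_in_imset gI); apply: eq_card => h.
apply/imsetP/idP => [[f /setIdP[/linextP[fA fd fI fM] /eqP fx] ->]|].
  apply/linextP; split.
  - move=> y /setD1P[yx yA]; rewrite ffunE (negPf yx) AxE.
    have fyx : f y <> f x by move=> /(fI _ _ yA xA)/eqP; rewrite (negPf yx).
    have := fA _ yA; rewrite -[X in _ < X](prednK A_gt0) ltnS leq_eqVlt -fx.
    by case/orP => // /eqP/val_inj.
  - move=> y; rewrite !inE negb_and negbK ffunE.
    by case: eqP => //= _; exact: fd.
  - move=> y z /setD1P[yx yA] /setD1P[zx zA].
    by rewrite !ffunE (negPf yx) (negPf zx) => /fI; apply.
  - move=> y z /setD1P[yx yA] /setD1P[zx zA].
    by rewrite !ffunE (negPf yx) (negPf zx); apply: fM.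
move=> /linextP[]; rewrite AxE => hA hd hI hM.
pose f := [ffun y => if y == x then Ordinal lN else h y].
have hlt y : y \in A -> y != x -> h y < #|A|.-1.
  by move=> yA yx; apply: hA; rewrite !inE yx.
exists f; last first.
  apply/ffunP => y; rewrite !ffunE; case: eqP => // ->.
  by apply: hd; rewrite !inE eqxx.
rewrite inE ffunE eqxx eqxx andbT; apply/linextP; split.
- move=> y yA; rewrite ffunE; case: eqVneq => [_|yx] /=; first by rewrite prednK.
  exact: leq_trans (hlt _ yA yx) (leq_pred _).
- move=> y yA; rewrite ffunE; case: eqVneq => [yx|yx]; last first.
    by apply: hd; rewrite !inE negb_and yA orbT.
  by rewrite yx xA in yA.
- move=> y z yA zA; rewrite !ffunE.
  case: (eqVneq y x) => [->|yx]; case: (eqVneq z x) => [->|zx] // E.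
  + by have := hlt _ zA zx; rewrite -E ltnn.
  + by have := hlt _ yA yx; rewrite E ltnn.
  + by apply: hI => //; rewrite !inE ?yx ?zx.
- move=> y z yA zA eyz; rewrite !ffunE.
  case: (eqVneq y x) => [yx|yx]; first by move: (xmax _ zA); rewrite -yx eyz.
  case: (eqVneq z x) => [zx|zx] /=; first exact: hlt.
  by apply: hM => //; rewrite !inE ?yx ?zx.
Qed.

Lemma card_linext0 : #|linext set0| = 1.
Proof.
rewrite -(cards1 [ffun _ : C => d]); apply: eq_card => f; rewrite in_set1.
apply/linextP/eqP => [[_ fd _ _]|->].
  by apply/ffunP => x; rewrite ffunE fd ?inE.
by split=> [x|x|x y|x y]; rewrite ?inE ?ffunE.
Qed.

Lemma card_linext_rec A : #|A| <= N -> A != set0 ->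
  #|linext A| = \sum_(x in A | maximal_in A x) #|linext (A :\ x)|.
Proof.
move=> AN A0.
rewrite -sum1_card.
(* The inner sum is 1: exactly one element of [A] carries the top label, and it is maximal. *)
transitivity (\sum_(f in linext A)
    \sum_(x in A | maximal_in A x) (f x == #|A|.-1 :> nat)).
  apply: eq_bigr => f fL; have [x xA fx] := linext_top fL A0.
  have xm := linext_top_maximal fL xA fx.
  rewrite (bigD1 x) /=; last by rewrite xA.
  rewrite fx eqxx big1 // => y /andP[/andP[yA _] yx].
  apply/eqP; rewrite eqb0 -fx; apply: contra yx => /eqP fxy; apply/eqP.
  by have /linextP[_ _ fI _] := fL; apply: fI => //; apply/val_inj.
rewrite exchange_big /=; apply: eq_bigr => x /andP[xA xm].
rewrite -(card_linext_top AN xA xm) -[RHS]sum1_card.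
rewrite [LHS]big_mkcond [RHS]big_mkcond /=; apply: eq_bigr => f _.
by move: (linext A) => L; rewrite in_set; case: (f \in L) => //=; case: eqP.
Qed.

End LinearExtensions.

(** * Schur's product formula *)

Section Lagrange.
Local Open Scope ring_scope.
Variables (F : fieldType) (I : finType).
Implicit Types (P : pred I) (u b : I -> F).

Let prodX P u := \prod_(j | P j) ('X - (u j)%:P).

Let prodXE P u : prodX P u = \prod_(x <- [seq u j | j <- enum P]) ('X - x%:P).
Proof. by rewrite big_map big_enum. Qed.

Let size_prodX P u : size (prodX P u) = #|P|.+1.
Proof. by rewrite prodXE size_prod_XsubC size_map cardE. Qed.

Let coef_prodX P u : (prodX P u)`_#|P| = 1.
Proof.
have /monicP := monic_prod_XsubC (enum P) xpredT u.
by rewrite /lead_coef big_enum -/(prodX P u) size_prodX.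
Qed.

Let coef_prodX1 P u : (0 < #|P|)%N ->
  (prodX P u)`_#|P|.-1 = - \sum_(j | P j) u j.
Proof.
move=> P0; have := @coefPn_prod_XsubC _ [seq u j | j <- enum P].
rewrite -prodXE size_map -cardE big_map big_enum; apply.
by rewrite -lt0n.
Qed.

Let horner_prodX P u x : (prodX P u).[x] = \prod_(j | P j) (x - u j).
Proof. by rewrite horner_prod; apply: eq_bigr => j _; rewrite hornerXsubC. Qed.

(* Compare the coefficients of degree #|P| - 1 in the Lagrange interpolation
   of [prod_j (X - b j) - prod_j (X - u j)] at the points [u i]. *)
Lemma lagrange_sum P u b : {in P &, injective u} ->
  \sum_(i | P i) (\prod_(j | P j) (u i - b j)) /
                 (\prod_(j | P j && (j != i)) (u i - u j)) =
  \sum_(i | P i) (u i - b i).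
Proof.
move=> uI.
have [P0|] := posnP #|P|.
  by rewrite !big_pred0 // => i; have := card0_eq P0 i.
move=> P0; pose c i := (\prod_(j | P j) (u i - b j)) /
  (\prod_(j | P j && (j != i)) (u i - u j)).
change (\sum_(i | P i) c i = \sum_(i | P i) (u i - b i)).
pose D := prodX P b - prodX P u.
pose Q := \sum_(i | P i) (c i)%:P * prodX [pred j | P j & j != i] u.
have cardPi i : P i -> #|[pred j | P j & j != i]| = #|P|.-1.
  move=> Pi; rewrite [in RHS](cardD1 i) [i \in _]Pi /=.
  by apply: eq_card => j; rewrite !inE andbC.
have sD : (size D <= #|P|)%N.
  apply/leq_sizeP => j; rewrite leq_eqVlt => /predU1P[<-|jP].
    by rewrite coefB !coef_prodX subrr.
  by rewrite coefB !nth_default ?subrr // size_prodX.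
have sQ : (size Q <= #|P|)%N.
  apply: leq_trans (size_sum _ _ _) _; apply/bigmax_leqP => i Pi.
  rewrite mul_polyC; apply: leq_trans (size_scale_leq _ _) _.
  by rewrite size_prodX cardPi // prednK.
have DQ : D = Q.
  apply/eqP; rewrite -subr_eq0; apply/eqP.
  apply: (@roots_geq_poly_eq0 _ _ [seq u j | j <- enum P]).
  - apply/allP => x /mapP[i]; rewrite mem_enum => Pi {x}->.
    rewrite /root hornerD hornerN /D /Q hornerD hornerN !horner_prodX.
    have -> : \prod_(j | P j) (u i - u j) = 0.
      by rewrite (bigD1 i) //= subrr mul0r.
    rewrite subr0.
    have -> : (\sum_(k | P k) (c k)%:P * prodX [pred j | P j & j != k] u).[u i]
        = c i * \prod_(j | P j && (j != i)) (u i - u j).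
      rewrite horner_sum (bigD1 i) //= big1 => [|j /andP[Pj ji]].
        by rewrite hornerM hornerC horner_prodX addr0.
      rewrite hornerM horner_prodX (bigD1 i) /= ?subrr ?mul0r ?mulr0 //.
      by rewrite [P i]Pi eq_sym.
    rewrite /c divfK ?subrr //.
    apply/prodf_neq0 => j /andP[Pj ji]; rewrite subr_eq0.
    by apply: contra ji => /eqP/(uI _ _ Pi Pj)->.
  - rewrite map_inj_in_uniq ?enum_uniq // => i j; rewrite !mem_enum.
    exact: uI.
  - rewrite size_map -cardE; apply: leq_trans (size_polyD _ _) _.
    by rewrite size_polyN geq_max sD.
have := congr1 (fun p : {poly F} => p`_#|P|.-1) DQ.
rewrite /D /Q coefB !coef_prodX1 // coef_sum => E.
transitivity (\sum_(i | P i) ((c i)%:P * prodX [pred j | P j & j != i] u)`_#|P|.-1).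
  by apply: eq_bigr => i Pi; rewrite coefCM -(cardPi i Pi) coef_prodX mulr1.
by rewrite -E sumrB opprK addrC.
Qed.

(* With [z = x i], the identity [(z - 1 - y) (z + y) = z (z - 1) - y (y + 1)]
   turns this into [lagrange_sum] at the points [x i (x i - 1)]. *)
Lemma strict_partition_sum P (x : I -> F) : (2 : F) != 0 ->
  {in P &, forall i j, i != j -> x i != x j /\ x i + x j != 1} ->
  \sum_(i | P i) x i * \prod_(j | P j && (j != i))
     ((x i - 1 - x j) * (x i + x j) / ((x i - 1 + x j) * (x i - x j))) =
  \sum_(i | P i) x i.
Proof.
move=> two_neq0 xP.
pose u i := x i * (x i - 1); pose b i := x i * (x i + 1).
have uI : {in P &, injective u}.
  move=> i j Pi Pj; apply: contra_eq => ij; have [xij xij1] := xP i j Pi Pj ij.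
  rewrite -subr_eq0; have -> : u i - u j = (x i - x j) * (x i + x j - 1).
    by rewrite /u; ring.
  by rewrite mulf_neq0 // subr_eq0.
have := @lagrange_sum P u b uI.
have -> : \sum_(i | P i) (u i - b i) = - 2 * \sum_(i | P i) x i.
  by rewrite mulr_sumr; apply: eq_bigr => i _; rewrite /u /b; ring.
move=> E; apply: (@mulfI _ (- 2)); first by rewrite oppr_eq0.
rewrite -E mulr_sumr; apply: eq_bigr => i Pi.
rewrite (bigD1 i Pi) /= -mulrA -prodf_div mulrA; congr (_ * _).
  by rewrite /u /b; ring.
apply: eq_bigr => j /andP[Pj ji].
congr (_ / _); rewrite /u /b; ring.
Qed.
End Lagrange.

(** Changing one part affects only the pairs that contain [k]; their corrections merge into one
    product over [j != k], on whichever side of [k] the index lies. *)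
Lemma prod_pairs_update (F : comPzRingType) (n : nat) (k : 'I_n)
    (G H : 'I_n -> 'I_n -> F) (rho : 'I_n -> F) :
  (forall i j : 'I_n, (i < j)%N -> i != k -> j != k -> H i j = G i j) ->
  (forall j : 'I_n, (k < j)%N -> H k j = G k j * rho j)%R ->
  (forall i : 'I_n, (i < k)%N -> H i k = G i k * rho i)%R ->
  (\prod_(i < n) \prod_(j < n | (i < j)%N) H i j =
   (\prod_(i < n) \prod_(j < n | (i < j)%N) G i j) * \prod_(j < n | j != k) rho j)%R.
Proof.
move=> Hoff Hrow Hcol.
pose c (i j : 'I_n) := if i == k then rho j else if j == k then rho i else 1%R.
transitivity (\prod_(i < n) \prod_(j < n | (i < j)%N) (G i j * c i j))%R.
  apply: eq_bigr => i _; apply: eq_bigr => j ij; rewrite /c.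
  case: eqVneq => [ik|ik]; first by rewrite ik in ij *; rewrite Hrow.
  case: eqVneq => [jk|jk]; first by rewrite jk in ij *; rewrite Hcol.
  by rewrite mulr1 Hoff.
under eq_bigr do rewrite big_split.
rewrite big_split /=; congr (_ * _)%R.
rewrite (bigD1 k) //= [RHS](bigID (fun j : 'I_n => k < j)%N) /=; congr (_ * _)%R.
  apply: eq_big => [j|j kj]; last by rewrite /c eqxx.
  rewrite andbC; case: ltnP => //= kj; apply/esym.
  by apply: contraTneq kj => ->; rewrite ltnn.
rewrite [LHS](bigID (fun j : 'I_n => k < j)%N) /= big1 ?mul1r; last first.
  move=> i /andP[ik ki]; apply: big1 => j ij; rewrite /c (negPf ik).
  by case: eqP => // jk; move: ij; rewrite jk ltnNge ltnW.
apply: eq_bigr => i /andP[ik]; rewrite -leqNgt leq_eqVlt => ki.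
have {}ki : (i < k)%N.
  by case/predU1P: ki => // /val_inj ki; rewrite ki eqxx in ik.
rewrite (bigD1 k) //= /c (negPf ik) eqxx big1 ?mulr1 // => j /andP[_ /negPf->].
by [].
Qed.

(** For the side conditions of [field]: each denominator is nonzero because it has a strict sign. *)
Ltac neq0_lra := repeat (apply/andP; split);
  solve [by rewrite lt_eqF //; lra | by rewrite gt_eqF //; lra].

(** * Schur's product and its change when a cell is removed *)

Section ShiftedShapes.
Variables (F : realFieldType) (n : nat).
Implicit Types (m : nat -> nat).

(* Parts of a strict partition with at most [n] parts, padded with zeros. *)
Definition strict_parts m :=
  forall i j, (i < j < n)%N -> (0 < m j)%N -> (m j < m i)%N.

Definition decr (k : nat) m i := if i == k then (m i).-1 else m i.

Local Open Scope ring_scope.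

(** The case [b = 0] makes padding zeros neutral; at [a = b = 0] the quotient would be [0 / 0], that
    is [0]. *)
Definition pair_factor (a b : nat) : F :=
  if b == 0%N then 1 else (a%:R - b%:R) / (a%:R + b%:R).

(* Schur's formula for the number of tableaux, divided by [|m|!]. *)
Definition hook_product m : F :=
  (\prod_(i < n) ((m i)`!%:R)^-1) *
  \prod_(i < n) \prod_(j < n | (i < j)%N) pair_factor (m i) (m j).

(** The factor by which [hook_product] changes when row [i] loses its last cell; also the summand of
    [strict_partition_sum] at the positive parts of [m]. *)
Definition corner_ratio m (i : 'I_n) : F :=
  (m i)%:R * \prod_(j < n | (0 < m j)%N && (j != i))
    (((m i)%:R - 1 - (m j)%:R) * ((m i)%:R + (m j)%:R) /
     (((m i)%:R - 1 + (m j)%:R) * ((m i)%:R - (m j)%:R))).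

Lemma hook_product_decr m (k : 'I_n) : strict_parts m -> (0 < m k)%N ->
  hook_product (decr k m) = hook_product m * corner_ratio m k.
Proof.
move=> sm mk.
pose rho (j : 'I_n) : F := if (0 < m j)%N then
    (((m k)%:R - 1 - (m j)%:R) * ((m k)%:R + (m j)%:R) /
     (((m k)%:R - 1 + (m j)%:R) * ((m k)%:R - (m j)%:R))) else 1.
have decrk : decr k m k = (m k).-1 by rewrite /decr eqxx.
have decrN (j : 'I_n) : j != k -> decr k m j = m j.
  by rewrite /decr => /negPf; rewrite -val_eqE => ->.
have natk : ((m k).-1)%:R = (m k)%:R - 1 :> F by rewrite -subn1 natrB.
rewrite /hook_product (@prod_pairs_update _ _ k
  (fun i j => pair_factor (m i) (m j)) _ rho); first last.
- move=> i ik; rewrite decrk decrN; last by rewrite -val_eqE neq_ltn ik.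
  have mik : (m k < m i)%N by apply: sm; rewrite ?ik ?ltn_ord.
  have mi : (0 < m i)%N by exact: leq_trans mik.
  rewrite /rho mi /pair_factor natk (gtn_eqF mk).
  have mik' : (m k)%:R + 1 <= (m i)%:R :> F by rewrite natr1 ler_nat.
  have mk' : 1 <= (m k)%:R :> F by rewrite ler1n.
  (* If [m k = 1], the row disappears and the new pair factor is 1 by convention; the old one times
     [rho i] is 1 as well. *)
  case: eqP => [k0|_].
    have mk1 : (m k)%:R = 1 :> F by apply/eqP; rewrite -subr_eq0 -natk k0.
    by clear k0 decrk; rewrite mk1 in mik' *; field; neq0_lra.
  by clear decrk; field; neq0_lra.
- move=> j kj; rewrite decrk decrN; last by rewrite -val_eqE neq_ltn kj orbT.
  rewrite /rho /pair_factor; case: posnP => [_|mj]; first by rewrite mulr1.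
  have mjk : (m j < m k)%N by apply: sm; rewrite ?kj ?ltn_ord.
  have mjk' : (m j)%:R + 1 <= (m k)%:R :> F by rewrite natr1 ler_nat.
  have mj' : 1 <= (m j)%:R :> F by rewrite ler1n.
  by rewrite natk; clear decrk; field; neq0_lra.
- by move=> i j _ ik jk; rewrite !decrN.
have -> : \prod_(i < n) ((decr k m i)`!%:R)^-1 =
    (\prod_(i < n) ((m i)`!%:R)^-1) * (m k)%:R :> F.
  rewrite (bigD1 k) //= [in RHS](bigD1 k) //= decrk mulrAC; congr (_ * _).
    rewrite -[in RHS](prednK mk) factS natrM invfM mulrAC mulVf ?mul1r //.
    by rewrite pnatr_eq0.
  by apply: eq_bigr => i ik; rewrite decrN.
rewrite /corner_ratio /rho -big_mkcondr /=.
rewrite -!mulrA; congr (_ * _); rewrite mulrCA; do 2!congr (_ * _).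
by apply: eq_bigl => j; rewrite andbC.
Qed.

Lemma corner_ratio0 m (i : 'I_n) : m i = 0%N -> corner_ratio m i = 0.
Proof. by move=> mi; rewrite /corner_ratio mi mul0r. Qed.

(** The factor [m i - 1 - m j] vanishes, so a sum over all rows is in effect a sum over corners. *)
Lemma corner_ratio_notcorner m (i : 'I_n) (j : 'I_n) :
  (0 < m j)%N -> (m i).-1 = m j -> j != i -> corner_ratio m i = 0.
Proof.
move=> mj mij ji; have mi : (0 < m i)%N by lia.
rewrite /corner_ratio (bigD1 j) /=; last by rewrite mj.
by rewrite -mij -subn1 natrB // subrr !mul0r mulr0.
Qed.

(** This is [strict_partition_sum] at the positive parts, where [x i + x j] cannot be 1. It drives
    the recursion for Schur's formula and later yields total mass 1. *)
Lemma sum_corner_ratio m : strict_parts m ->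
  \sum_(i < n) corner_ratio m i = (\sum_(i < n) m i)%:R.
Proof.
move=> sm; rewrite (bigID (fun i : 'I_n => (0 < m i)%N)) /=.
rewrite [X in _ + X]big1 ?addr0; last first.
  by move=> i; rewrite -eqn0Ngt => /eqP/corner_ratio0.
rewrite strict_partition_sum ?pnatr_eq0 // => [|i j].
  rewrite natr_sum [RHS](bigID (fun i : 'I_n => (0 < m i)%N)) /=.
  rewrite [X in _ + X]big1 ?addr0 // => i.
  by rewrite -eqn0Ngt => /eqP->.
rewrite !unfold_in => mi mj ij; have : (i < j)%N || (j < i)%N by rewrite -neq_ltn.
have -> : (m i)%:R + (m j)%:R != 1 :> F by rewrite -natrD pnatr_eq1; lia.
rewrite eqr_nat => /orP[] h; split=> //.
  by have := sm i j; rewrite h ltn_ord mj => /(_ isT isT); lia.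
by have := sm j i; rewrite h ltn_ord mi => /(_ isT isT); lia.
Qed.

End ShiftedShapes.

(** * Tableaux of subshapes of the staircase *)

Section StaircaseShapes.
Variables (F : realFieldType) (n' : nat).
Let n := n'.+1.
Let C := cell (staircase n).
Local Open Scope nat_scope.
Implicit Types (m : nat -> nat) (x y : C).

Definition cover : rel C :=
  fun x y => right_of (val x) (val y) || below (val x) (val y).

Lemma cellP x : (1 <= (val x).1 <= n) && ((val x).1 <= (val x).2 <= 2 * n - (val x).1).
Proof. by have := valP x; case: (val x) => i j; rewrite mem_staircase_diagram. Qed.

Lemma cell_ex i j : (1 <= i <= n) && (i <= j <= 2 * n - i) ->
  {x : C | val x = (i, j)}.
Proof. by rewrite -mem_staircase_diagram => p; exists (SeqSub p). Qed.

Lemma card_cell : #|{: C}| = n ^ 2.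
Proof.
rewrite card_seq_sub; last first.
  by apply: allpairs_uniq_dep => [|i _|[i j] [k l] _ _ [-> ->]]; rewrite ?iota_uniq.
rewrite size_allpairs_dep -(sumn_staircase n); congr sumn.
apply: (@eq_from_nth _ 0) => [|i]; rewrite size_map size_iota // => ilt.
by rewrite (nth_map 0) ?size_iota // nth_iota // size_iota.
Qed.

(** Cells are 1-indexed but [m] is 0-indexed, hence the [.-1]; the last cell of row [i] of [m] is
    [(i.+1, i + m i)]. *)
Definition subshape m : {set C} :=
  [set x | (val x).2 < (val x).1 + m (val x).1.-1].

Definition fits m := forall i, i < n -> m i <= 2 * (n - i) - 1.

Lemma decr_fits k m : fits m -> fits (decr k m).
Proof. by move=> fm i /fm; rewrite /decr; case: eqP => // _; lia. Qed.

Lemma subshape_decr m x (i : 'I_n) : 0 < m i -> val x = (i.+1, i + m i) ->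
  subshape m :\ x = subshape (decr i m).
Proof.
move=> mi xE; apply/setP => y; rewrite !inE -val_eqE xE /decr.
have := cellP y; case: (val y) => a b /= ab.
rewrite xpair_eqE; case: (eqVneq a.-1 i) => [ai|ai]; rewrite ?ai; lia.
Qed.

(** If the shortened row were as long as a later nonempty row, the cell below [x] would belong to
    the shape, against maximality. *)
Lemma maximal_strict_decr m x (i : 'I_n) : fits m -> strict_parts n m ->
  0 < m i -> val x = (i.+1, i + m i) ->
  maximal_in cover (subshape m) x -> strict_parts n (decr i m).
Proof.
move=> fm sm mi xE xmax a b ab; rewrite /decr.
case: (eqVneq b i) => [bi|bi].
  rewrite bi in ab *; case: eqP => [ai|_ _]; first by lia.
  by have := sm a i ab mi; lia.
case: (eqVneq a i) => [ai mb|_]; last exact: sm.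
rewrite ai in ab *; have mbi := sm i b ab mb.
rewrite ltnNge; apply/negP => mle.
have mbE : m i = (m b).+1 by lia.
(* Otherwise [m i.+1] would lie strictly between [m b] and [(m b).+1]. *)
have bE : b = i.+1.
  apply/eqP; apply: contraT => bi1.
  have h1 := sm i.+1 b; have h2 := sm i i.+1.
  have {}h1 : m b < m i.+1 by apply: h1 => //; lia.
  have : m i.+1 < m i by apply: h2 => //; lia.
  by lia.
(* [fits] at row [i.+1] keeps the cell below [x] inside the staircase. *)
have fb := fm b; rewrite bE in fb mbE ab mb.
have {}fb : m i.+1 <= 2 * (n - i.+1) - 1 by apply: fb; lia.
have [|y yE] := @cell_ex i.+2 (i + m i); first by lia.
have yS : y \in subshape m by rewrite inE yE /=; lia.
have /forall_inP/(_ y yS) := xmax.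
by rewrite /cover xE yE /right_of /below !xpair_eqE /= !eqxx ?orbT.
Qed.

(** The cell to the right of [x] is outside the shape, so the obstruction is the cell below, and
    strictness forces the next row to have [(m i).-1] cells. *)
Lemma notmaximal_next m x (i : 'I_n) : strict_parts n m ->
  0 < m i -> val x = (i.+1, i + m i) ->
  ~~ maximal_in cover (subshape m) x ->
  exists j : 'I_n, [/\ 0 < m j, (m i).-1 = m j & j != i].
Proof.
move=> sm mi xE /forall_inPn[y].
have := cellP y; rewrite inE negbK /cover xE /right_of /below.
case: (val y) => a b /= ab bm; rewrite !xpair_eqE.
move=> /orP[/andP[/eqP aE /eqP bE]|/andP[/eqP aE /eqP bE]].
  by rewrite aE /= in bm; lia.
have i1 : i.+1 < n by lia.
exists (Ordinal i1); rewrite -val_eqE /=; rewrite aE /= in bm.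
have := sm i i.+1; rewrite ltnSn i1 => /(_ isT) h.
have mi1 : 0 < m i.+1 by lia.
by have := h mi1; split; lia.
Qed.

Variables (d : 'I_(sumn (staircase n))).
Local Notation linext := (linext cover d).

Local Open Scope ring_scope.

(** Induction on the number of cells: the recursion over corners becomes a sum over all rows, which
    [sum_corner_ratio] evaluates. *)
Lemma card_linext_subshape m : fits m -> strict_parts n m ->
  #|linext (subshape m)|%:R =
  ((\sum_(i < n) m i)`!)%:R * hook_product F n m.
Proof.
have [k] := ubnP (\sum_(i < n) m i); elim: k m => // k IHk m mk fm sm.
have [m0|m0] := posnP (\sum_(i < n) m i).
  have mi (i : 'I_n) : m i = 0%N.
    by move/eqP: m0; rewrite sum_nat_eq0 => /forallP/(_ i)/eqP.
  have -> : subshape m = set0.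
    apply/setP => x; rewrite !inE; have := cellP x.
    case: (val x) => a b /= ab; have an : (a.-1 < n)%N by lia.
    by rewrite (mi (Ordinal an)); lia.
  rewrite card_linext0 m0 mul1r /hook_product !big1 ?mulr1 // => i _.
    by rewrite big1 // => j _; rewrite /pair_factor mi.
  by rewrite mi invr1.
have [x0 x0E] : {x : C | val x = (1, 1)%N} by apply: cell_ex; lia.
(* [h] sends a row to its last cell and [h'] a cell to its row; empty rows may fall back on the
   default [x0]. *)
pose h (i : 'I_n) : C := insubd x0 (i.+1, i + m i)%N.
pose h' x : 'I_n := inord (val x).1.-1.
have hE (i : 'I_n) : (0 < m i)%N -> val (h i) = (i.+1, i + m i)%N.
  move=> mi; rewrite /h /insubd insubT //=.
  by rewrite mem_staircase_diagram; have := fm i (ltn_ord i); have := ltn_ord i; lia.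
have h'E x : val (h' x) = (val x).1.-1.
  by rewrite /= inordK //; have := cellP x; lia.
have lam0 : (subshape m != set0).
  have /existsP[i mi] : [exists i : 'I_n, (0 < m i)%N].
    apply: contraLR m0; rewrite negb_exists -eqn0Ngt sum_nat_eq0.
    by move=> /forallP H; apply/forallP => i; rewrite eqn0Ngt H.
  by apply/set0Pn; exists (h i); rewrite inE hE //=; lia.
rewrite card_linext_rec //; last first.
  by apply: leq_trans (max_card _) _; rewrite card_cell sumn_staircase.
(* A maximal cell ends its row, since otherwise its right neighbour would lie in the shape. *)
rewrite (reindex_onto h h') /=; last first.
  move=> x /andP[]; rewrite inE => xS xmax.
  have xC := cellP x; have h'x := h'E x; have hx := ltn_ord (h' x).
  case E: (val x) => [a b]; rewrite E /= in xC xS h'x *.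
  rewrite /= in h'x; rewrite h'x in hx.
  have ma : (0 < m a.-1)%N by lia.
  apply/val_inj; rewrite hE h'x // E.
  suff -> : (a.-1 + m a.-1)%N = b by rewrite prednK //; lia.
  apply/eqP; apply: contraT => bneq.
  have [|y yE] := @cell_ex a b.+1; first by have := fm _ hx; lia.
  have yS : y \in subshape m by rewrite inE yE /=; lia.
  have /forall_inP/(_ y yS) := xmax.
  by rewrite /cover yE E /right_of eqxx.
(* An empty row is sent to [x0], which lies in row 0; it could pass the test only for [i = 0], but
   then [x0] is not in the shape. *)
have cond (i : 'I_n) : (h i \in subshape m) && (h' (h i) == i) = (0 < m i)%N.
  case: (posnP (m i)) => mi; last first.
    by rewrite inE -val_eqE h'E hE //= eqxx andbT; lia.
  apply/negbTE/negP => /andP[hS /eqP hi].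
  have := congr1 val hi; rewrite h'E /h /insubd insubN /=; last first.
    by rewrite mem_staircase_diagram; lia.
  move=> i0; move: hS; rewrite inE /h /insubd insubN /= ?x0E /=.
    by rewrite x0E /= in i0; move: mi; rewrite -i0 => ->.
  by rewrite mem_staircase_diagram; lia.
rewrite natr_sum.
set S := (\sum_(i < n) m i)%N in mk m0 *.
transitivity (\sum_(i < n) (S.-1)`!%:R * hook_product F n m * corner_ratio F m i).
  rewrite [LHS]big_mkcond /=; apply: eq_bigr => i _.
  rewrite andbAC cond; case: posnP => mi /=.
    by rewrite corner_ratio0 ?mulr0.
  case: ifPn => [imax|inmax]; last first.
    have [j [mj mij ji]] := notmaximal_next sm mi (hE _ mi) inmax.
    by rewrite (corner_ratio_notcorner _ mj mij ji) mulr0.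
  have smi := maximal_strict_decr fm sm mi (hE _ mi) imax.
  rewrite (subshape_decr mi (hE _ mi)).
  have SE : S.-1 = (\sum_(j < n) decr i m j)%N.
    rewrite /S (bigD1 i) //= [in RHS](bigD1 i) //= /decr eqxx.
    rewrite -{1}(prednK mi) addSn /=; congr (_ + _)%N; apply: eq_bigr => j.
    by rewrite -val_eqE => /negPf->.
  rewrite IHk //; last 2 first.
  - by rewrite -SE; lia.
  - exact: decr_fits.
  by rewrite -SE hook_product_decr // mulrA.
rewrite -mulr_sumr sum_corner_ratio // -/S -{3}(prednK m0) factS prednK //.
by rewrite natrM; ring.
Qed.

End StaircaseShapes.

(** * The law of the position of the maximal label *)

Definition odd_parts (n i : nat) : nat := 2 * (n - i) - 1.

Lemma odd_parts_fits n' : fits n' (odd_parts n'.+1).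
Proof. by move=> i; rewrite /odd_parts. Qed.

Lemma odd_parts_strict n : strict_parts n (odd_parts n).
Proof. by move=> i j ij; rewrite /odd_parts; lia. Qed.

Lemma subshape_full n' : subshape n' (odd_parts n'.+1) = [set: cell (staircase n'.+1)].
Proof.
apply/setP => x; rewrite !inE /odd_parts; have := cellP x.
by case: (val x) => a b /=; lia.
Qed.

Lemma sum_odd_parts n : \sum_(i < n) odd_parts n i = n ^ 2.
Proof.
rewrite (reindex_inj rev_ord_inj) /=.
under eq_bigr => i _ do rewrite /odd_parts subKn //.
elim: n => [|n IHn]; first by rewrite big_ord0.
by rewrite big_ord_recr /= IHn; lia.
Qed.

(** With every cell in [A] the dummy label does not occur, and there are as many cells as labels, so
    injective fillings are onto. *)
Lemma SYT_linext n' (d : 'I_(sumn (staircase n'.+1))) :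
  SYT (staircase n'.+1) = linext (@cover n') d setT.
Proof.
have cE : #|[set: cell (staircase n'.+1)]| = sumn (staircase n'.+1).
  by rewrite cardsT card_cell sumn_staircase.
apply/setP => T; rewrite inE; apply/and3P/linextP => [[/injectiveP TI _ TM]|].
  split=> [x _|x|x y _ _ /TI//|x y _ _ xy]; rewrite ?inE ?cE ?ltn_ord //.
  by have /forallP/(_ y)/implyP/(_ xy) := forallP TM x.
case=> _ _ TI TM; have {}TI : injective T by move=> x y /TI; apply; rewrite inE.
split; first exact/injectiveP.
  apply/forallP => k; have [||g _ gK] := @inj_card_bij _ _ T; rewrite ?card_ord //.
    by rewrite -cE cardsT.
  by apply/existsP; exists (g k); rewrite gK.
by apply/forallP => x; apply/forallP => y; apply/implyP; apply: TM; rewrite inE.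
Qed.

Section MaxLabel.
Variables (F : realFieldType) (n' : nat).
Let n := n'.+1.

Lemma max_label_pos_eq (T : filling (staircase n)) (r : 'I_n) c :
  T \in SYT (staircase n) -> val c = (n - r, n + r) ->
  (max_label_pos T == r) = (T c == (n ^ 2).-1 :> nat).
Proof.
move=> TS cE; have /andP[rn /existsP[c' /andP[/eqP c'E /eqP lc']]] :=
  max_label_posP (ltn0Sn n') TS.
move: TS; rewrite inE => /and3P[/injectiveP TI _ _].
have {}lc' : T c' = (n ^ 2).-1 :> nat by rewrite -lc'.
rewrite -lc'; apply/eqP/eqP => [rE|/val_inj/TI cc'].
  by do 2!congr (_ _); apply/val_inj; rewrite cE c'E rE.
by move: c'E; rewrite -cc' cE => -[_ /addnI->].
Qed.

(** The cell [(n - r, n + r)] ends the row of 0-based index [rev_ord r]. Removing it turns the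
    numerator into a count for the shortened shape, and the quotient of the two Schur products is
    [corner_ratio]. *)
Lemma card_max_label_pos (r : 'I_n) :
  (#|[set T in SYT (staircase n) | max_label_pos T == r]|%:R /
   #|SYT (staircase n)|%:R =
   corner_ratio F (odd_parts n) (rev_ord r) / (n ^ 2)%:R)%R.
Proof.
have n2 : 0 < sumn (staircase n) by rewrite sumn_staircase.
pose d := Ordinal n2.
have [|c cE] := @cell_ex n' (n - r) (n + r); first by have := ltn_ord r; lia.
have cE' : val c = ((rev_ord r).+1, rev_ord r + odd_parts n (rev_ord r)).
  by rewrite cE /odd_parts /=; congr pair; have := ltn_ord r; lia.
have op_gt0 : 0 < odd_parts n (rev_ord r).
  by rewrite /odd_parts /=; have := ltn_ord r; lia.
have fo := @odd_parts_fits n'; have so := @odd_parts_strict n.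
have cardT : #|[set: cell (staircase n)]| = n ^ 2 by rewrite cardsT card_cell.
have cT : c \in [set: cell (staircase n)] by rewrite inE.
have cmax : maximal_in (@cover n') setT c.
  apply/forall_inP => y _; rewrite /cover cE /right_of /below.
  have := cellP y; case: (val y) => a b /= ab; rewrite !xpair_eqE; lia.
have -> : [set T in SYT (staircase n) | max_label_pos T == r] =
    [set T in linext (@cover n') d setT | T c == #|[set: cell (staircase n)]|.-1 :> nat].
  rewrite (SYT_linext d) cardT; apply/setP => T; rewrite [LHS]inE [RHS]inE.
  rewrite -(SYT_linext d); apply/andb_id2l => TS; exact: max_label_pos_eq.
rewrite card_linext_top // ?cardT ?sumn_staircase // (SYT_linext d).
rewrite -subshape_full (subshape_decr op_gt0 cE').
rewrite subshape_full in cmax *; rewrite -subshape_full in cmax *.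
have sd := maximal_strict_decr fo so op_gt0 cE' cmax.
rewrite !card_linext_subshape //; last exact: decr_fits.
have S1 : \sum_(i < n) decr (rev_ord r) (odd_parts n) i = (n ^ 2).-1.
  rewrite -sum_odd_parts (bigD1 (rev_ord r)) //= [in RHS](bigD1 (rev_ord r)) //=.
  rewrite -[in RHS](prednK op_gt0) addSn /= /decr eqxx; congr (_ + _).
  by apply: eq_bigr => j; rewrite -val_eqE => /negPf->.
rewrite S1 sum_odd_parts hook_product_decr // -[in X in (_ / X)%R](@prednK (n ^ 2)) //.
rewrite factS natrM prednK //.
have h0 : hook_product F n (odd_parts n) != 0%R.
  rewrite /hook_product mulf_neq0 //; apply/prodf_neq0 => i _.
    by rewrite invr_eq0 pnatr_eq0 -lt0n fact_gt0.
  apply/prodf_neq0 => j ij; rewrite /pair_factor; case: (eqVneq (odd_parts n j) 0) => [_|jn0].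
    exact: oner_neq0.
  have := so i j; rewrite ij ltn_ord lt0n jn0 => /(_ isT isT) h.
  by rewrite mulf_neq0 ?invr_eq0 // ?subr_eq0 -?natrD ?eqr_nat ?pnatr_eq0; lia.
by field; rewrite h0 !pnatr_eq0 -!lt0n fact_gt0.
Qed.

Lemma uniform_pr_max_label_pos (E : pred nat) :
  (#|[set T in SYT (staircase n) | E (max_label_pos T)]|%:R /
   #|SYT (staircase n)|%:R =
  \sum_(r < n | E r) corner_ratio F (odd_parts n) (rev_ord r) / (n ^ 2)%:R)%R.
Proof.
under eq_bigr => r _ do rewrite -card_max_label_pos.
rewrite -mulr_suml -natr_sum; congr (_ * _)%R; congr (_ %:R)%R.
under eq_bigr => r _ do rewrite -sum1_card.
rewrite -sum1_card (exchange_big_dep (fun T => (T \in SYT (staircase n)) && E (max_label_pos T))) /=.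
  rewrite big_mkcond [RHS]big_mkcond; apply: eq_bigr => T _.
  rewrite inE; case: ifP => // /andP[TS ET].
  have /andP[pn _] := max_label_posP (ltn0Sn n') TS.
  rewrite (big_pred1 (Ordinal pn)) // => r; rewrite inE TS /= -val_eqE /= eq_sym.
  by case: eqP => [->|]; rewrite ?ET ?andbF.
by move=> r T Er; rewrite inE => /andP[-> /eqP->].
Qed.
End MaxLabel.

(** * Wallis products and the explicit law *)

Section Wallis.
Variable F : realFieldType.
Local Open Scope ring_scope.

(** The central binomial coefficient of [2 * k] over [k], divided by [4 ^ k]. *)
Definition wallis (k : nat) : F :=
  \prod_(i < k) ((2 * i%:R + 1) / (2 * i%:R + 2)).

Lemma wallisS k : wallis k.+1 = wallis k * ((2 * k%:R + 1) / (2 * k%:R + 2)).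
Proof. by rewrite /wallis big_ord_recr. Qed.

Lemma wallis_gt0 k : 0 < wallis k.
Proof.
apply: prodr_gt0 => i _; have i0 : 0 <= i%:R :> F by rewrite ler0n.
by apply: divr_gt0; lra.
Qed.

Lemma wallisD k l :
  wallis (k + l) = wallis k *
    \prod_(i < l) ((2 * (k%:R + i%:R) + 1) / (2 * (k%:R + i%:R) + 2)).
Proof.
rewrite /wallis big_split_ord /=; congr (_ * _).
by apply: eq_bigr => i _; rewrite natrD.
Qed.

(** The factor of [corner_ratio] for rows of lengths [2 * x + 1] and [2 * y + 1]. *)
Let T (x y : F) : F :=
  (2 * x + 1 - 1 - (2 * y + 1)) * (2 * x + 1 + (2 * y + 1)) /
  ((2 * x + 1 - 1 + (2 * y + 1)) * (2 * x + 1 - (2 * y + 1))).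

(** [T r s] splits into a factor in [r - s], whose product is [wallis r] read backwards, and one in
    [r + s], whose product is [wallis r / wallis (r + r)] by [wallisD]. *)
Let prodT_base (r : nat) : \prod_(s < r) T r%:R s%:R = wallis r ^+ 2 / wallis (r + r).
Proof.
have wrev : wallis r =
    \prod_(s < r) ((2 * (r%:R - s%:R) - 1) / (2 * (r%:R - s%:R))).
  rewrite /wallis (reindex_inj rev_ord_inj); apply: eq_bigr => s _ /=.
  by rewrite natrB // -natr1; congr (_ / _); ring.
rewrite wallisD expr2 -mulf_div divff ?mul1r ?gt_eqF ?wallis_gt0 // wrev.
rewrite -prodfV -big_split /=; apply: eq_bigr => s _.
have r0 : 0 <= s%:R :> F by rewrite ler0n.
have sr : s%:R + 1 <= r%:R :> F by rewrite natr1 ler_nat.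
by rewrite /T; field; neq0_lra.
Qed.

Lemma corner_ratio_odd_parts (n : nat) (r : 'I_n) :
  corner_ratio F (odd_parts n) (rev_ord r) =
  (4 * r%:R + 1) * (n%:R - r%:R) * wallis r ^+ 2 * wallis (n - r) / wallis (n + r).
Proof.
have opE (s : 'I_n) : (odd_parts n (rev_ord s))%:R = 2 * s%:R + 1 :> F.
  have -> : odd_parts n (rev_ord s) = (2 * s + 1)%N.
    by rewrite /odd_parts /=; have := ltn_ord s; lia.
  by rewrite natrD natrM.
rewrite /corner_ratio opE (reindex_inj rev_ord_inj) /=.
transitivity ((2 * r%:R + 1) * \prod_(s < n | s != r :> nat) T r%:R s%:R).
  congr (_ * _); apply: eq_big => s; last by move=> _; rewrite opE.
  rewrite (inj_eq rev_ord_inj) -val_eqE andb_idl // => _.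
  by rewrite /odd_parts /=; have := ltn_ord s; lia.
(* Induction on the number [k] of rows longer than [2 * r + 1]: the shorter ones give [prodT_base],
   and each longer one contributes one more factor [T]. *)
have [k nE] : {k | n = r.+1 + k}%N.
  by exists (n - r.+1)%N; have := ltn_ord r; lia.
have r0 : 0 <= r%:R :> F by rewrite ler0n.
move: (nat_of_ord r) r0 nE => {opE r} r r0 ->; elim: k => [|k IHk].
  rewrite addn0 big_mkcond big_ord_recr /= eqxx mulr1.
  under eq_bigr => s _ do rewrite ltn_eqF ?ltn_ord //=.
  have w1 : wallis 0 = 1 by rewrite /wallis big_ord0.
  rewrite prodT_base subSnn addSn !wallisS w1 natrD -(natr1 r) mulr0n.
  have w0 : wallis (r + r) != 0 by rewrite gt_eqF ?wallis_gt0.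
  by field; rewrite w0 ?andbT /=; neq0_lra.
rewrite addnS big_mkcond big_ord_recr /= -big_mkcond /= mulrA IHk.
rewrite ifT; last by lia.
have -> : ((r.+1 + k).+1 - r = (k.+1).+1)%N by lia.
have -> : (r.+1 + k - r = k.+1)%N by lia.
rewrite (addSn (r.+1 + k) r) (wallisS (r.+1 + k + r)) (wallisS k.+1).
have k0 : 0 <= k%:R :> F by rewrite ler0n.
have := wallis_gt0 (r.+1 + k + r); move: (wallis (r.+1 + k + r)) => w w0.
move: (wallis k.+1) => v.
rewrite -(natr1 (r.+1 + k)) !natrD -(natr1 r) -(natr1 k) /T.
by field; neq0_lra.
Qed.

End Wallis.

From mathcomp Require Import all_classical all_reals all_analysis.
Import numFieldNormedType.Exports.
Local Open Scope classical_set_scope.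
Local Open Scope ring_scope.

(** * The semicircle law *)

Section Semicircle.
Variable R : realType.
Implicit Types (x y a b : R).

Definition semicircle x : R := Num.sqrt (1 - x ^+ 2).
(** Times [4 / pi], this is the limiting distribution function on [[0, 1]]. *)
Definition semicircle_primitive x : R := 2^-1 * (x * semicircle x + asin x).

Local Notation f := semicircle.
Local Notation G := semicircle_primitive.

Lemma semicircle_ge0 x : 0 <= f x.
Proof. exact: sqrtr_ge0. Qed.

Lemma semicircle_le1 x : f x <= 1.
Proof.
rewrite -[leRHS]sqrtr1 ler_sqrt ?ler01 //.
by have := sqr_ge0 x; lra.
Qed.

Lemma semicircle_decr x y : 0 <= x -> x <= y -> f y <= f x.
Proof. by move=> x0 xy; apply: ler_wsqrtr; nra. Qed.

Lemma continuous_semicircle : continuous f.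
Proof.
move=> x; apply: (@continuous_comp _ _ _ (fun x : R => 1 - x ^+ 2)).
  by apply: continuousB; [exact: cst_continuous|exact: exprn_continuous].
exact: sqrt_continuous.
Qed.

(** [asin] inverts the continuous function [sin] on a segment; the closed interval matters because
    [x = 1] is used later. *)
Lemma continuous_asin_itv : {within `[-1, 1], continuous (@asin R)}.
Proof.
have pi0 := pi_ge0 R.
have := @segment_can_le_continuous R (- (pi / 2)) (pi / 2) sin asin.
rewrite sinN sin_pihalf; apply; first by lra.
  by apply: continuous_subspaceT => x; exact: continuous_sin.
exact: sinK.
Qed.

Lemma continuous_semicircle_primitive a b : 0 <= a -> b <= 1 ->
  {within `[a, b], continuous G}.
Proof.
move=> a0 b1; suff : {within `[-1, 1], continuous G}.
  apply: continuous_subspaceW => x /=; rewrite !in_itv /= => /andP[? ?].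
  by apply/andP; split; lra.
move=> x; apply: cvgM; first exact: cvg_cst.
apply: cvgD; last exact: continuous_asin_itv.
apply: cvgM; apply: continuous_subspaceT => {}x //.
exact: continuous_semicircle.
Qed.

Lemma is_derive_semicircle_primitive x : -1 < x < 1 -> is_derive x 1 G (f x).
Proof.
move=> x1; have fx : 0 < 1 - x ^+ 2 by nra.
have f0 : 0 < f x by rewrite sqrtr_gt0.
have f2 : f x ^+ 2 = 1 - x ^+ 2 by rewrite sqr_sqrtr // ltW.
have dsq : is_derive x 1 (cst 1 - (id : R -> R) ^+ 2) (- (2 * x)).
  by apply: is_derive_eq; rewrite /GRing.scale /=; ring.
have df := @is_derive1_comp _ Num.sqrt (cst 1 - (id : R -> R) ^+ 2) x _ _
    (is_derive1_sqrt fx) dsq.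
have dG := is_deriveZ 2^-1 (is_deriveD (is_deriveM (is_derive_id x 1) df)
  (is_derive1_asin x1)).
apply: (@is_derive_eq _ _ _ _ _ _ _ _ dG); rewrite -/(f x) /GRing.scale /=.
rewrite -[Num.sqrt _]/(f x).
(* The terms [- x ^+ 2 / f x] and [1 / f x] of the derivative combine into the first summand, which
   equals [f x]. *)
transitivity (2^-1 * ((1 - x ^+ 2) / f x + f x)); last by rewrite -f2; field; lra.
by field; rewrite gt_eqF.
Qed.

(** Mean value theorem with [f] decreasing; differentiability is required only inside, so [y = 1] is
    allowed. *)
Lemma semicircle_primitive_incr x y : 0 <= x -> x <= y -> y <= 1 ->
  f y * (y - x) <= G y - G x <= f x * (y - x).
Proof.
move=> x0 xy y1.
have [||c] := @MVT_segment _ G f x y xy.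
- move=> z; rewrite in_itv /= => /andP[xz zy].
  by apply: is_derive_semicircle_primitive; apply/andP; split; lra.
- exact: continuous_semicircle_primitive.
rewrite in_itv /= => /andP[xc cy] ->.
by rewrite !ler_wpM2r ?subr_ge0 ?semicircle_decr //; lra.
Qed.

Lemma semicircle_primitive_lipschitz x y : 0 <= x <= 1 -> 0 <= y <= 1 ->
  `|G y - G x| <= `|y - x|.
Proof.
wlog xy : x y / x <= y => [H|] x01 y01.
  have [/H h|/ltW/H h] := leP x y; first exact: h.
  by rewrite distrC [leRHS]distrC; exact: h.
have [x0 y1] : 0 <= x /\ y <= 1 by split; lra.
have /andP[l u] := semicircle_primitive_incr x0 xy y1.
have := semicircle_ge0 y; have := semicircle_le1 x => fx fy.
rewrite [leRHS]ger0_norm ?subr_ge0 // ger0_norm; last first.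
  by apply: le_trans l; rewrite mulr_ge0 // subr_ge0.
by apply: le_trans u _; rewrite ler_piMl // subr_ge0.
Qed.

Lemma semicircle_primitive0 : G 0 = 0.
Proof.
have pi0 := pi_ge0 R.
rewrite /G mul0r add0r -[X in asin X](@sin0 R) sinK ?mulr0 //.
by rewrite in_itv /=; apply/andP; split; lra.
Qed.

Lemma semicircle_primitive1 : G 1 = pi / 4.
Proof.
have pi0 := pi_ge0 R.
rewrite /G /f expr1n subrr sqrtr0 mulr0 add0r -[X in asin X](@sin_pihalf R) sinK.
  by field.
by rewrite in_itv /=; apply/andP; split; lra.
Qed.

Lemma integral_semicircle a b : 0 <= a -> a <= b -> b <= 1 ->
  \int[@lebesgue_measure R]_(x in `[a, b]) (4 / pi * Num.sqrt (1 - x ^+ 2)) =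
  4 / pi * (G b - G a).
Proof.
move=> a0; rewrite le_eqVlt => /predU1P[->|ab] b1.
  by rewrite set_itv1 Rintegral_set1 subrr mulr0.
have cf : {within `[a, b], continuous (fun x => 4 / pi * f x)}.
  apply: continuous_subspaceT => x; apply: cvgM; first exact: cvg_cst.
  exact: continuous_semicircle.
have cG : {within `[a, b], continuous (fun x => 4 / pi * G x)}.
  move=> x; apply: cvgM; first exact: cvg_cst.
  exact: continuous_semicircle_primitive.
have dG x : x \in `]a, b[ ->
    is_derive x 1 (fun x => 4 / pi * G x) (4 / pi * f x).
  rewrite in_itv /= => /andP[ax xb]; apply: (@is_deriveZ _ _ _ G).
  by apply: is_derive_semicircle_primitive; apply/andP; split; lra.
rewrite /Rintegral (@continuous_FTC2 _ _ (fun x => 4 / pi * G x)) //.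
- by rewrite -EFinB /= mulrBr.
- have /(continuous_within_itvP _ ab)[_ Ga Gb] := cG.
  by split; [move=> x /dG [dGx _]; exact: dGx|exact: Ga|exact: Gb].
- by move=> x /dG dGx; rewrite derive1E derive_val.
Qed.

End Semicircle.

(** * Bounds on Wallis products and on single probabilities *)

Section Estimates.
Variable R : realType.
Local Notation w := (wallis R).
Local Notation f := (@semicircle R).
Local Notation G := (@semicircle_primitive R).

Lemma wallis_sqr_lower_step k : k%:R * w k ^+ 2 <= k.+1%:R * w k.+1 ^+ 2.
Proof.
have k0 : 0 <= k%:R :> R by rewrite ler0n.
rewrite wallisS exprMn [leRHS]mulrCA [leLHS]mulrC ler_wpM2l ?sqr_ge0 // -natr1.
have -> : (k%:R + 1) * ((2 * k%:R + 1) / (2 * k%:R + 2)) ^+ 2 =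
    k%:R + (4 * (k%:R + 1))^-1 :> R by field; neq0_lra.
by rewrite lerDl invr_ge0; lra.
Qed.

Lemma wallis_sqr_upper_step k :
  (k.+1%:R + 2^-1) * w k.+1 ^+ 2 <= (k%:R + 2^-1) * w k ^+ 2.
Proof.
have k0 : 0 <= k%:R :> R by rewrite ler0n.
rewrite wallisS exprMn [leLHS]mulrCA [leRHS]mulrC ler_wpM2l ?sqr_ge0 // -natr1.
have -> : (k%:R + 1 + 2^-1) * ((2 * k%:R + 1) / (2 * k%:R + 2)) ^+ 2 =
    k%:R + 2^-1 - (2 * k%:R + 1) / (8 * (k%:R + 1) ^+ 2) :> R by field; neq0_lra.
by rewrite gerBl divr_ge0 ?mulr_ge0 ?sqr_ge0; lra.
Qed.

Lemma wallis_sqr_le k : (k%:R + 2^-1) * w k ^+ 2 <= 2^-1.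
Proof.
elim: k => [|k]; last exact/le_trans/wallis_sqr_upper_step.
by rewrite /wallis big_ord0 expr1n mulr1 add0r.
Qed.

(** The lower sequence increases, the upper one decreases, and [c] is the supremum of the lower one;
    the bounds on [c] come from the terms [k = 1] and [k = 0]. *)
Lemma wallis_sqr_bounds : exists2 c : R, 0 < c <= 2^-1 &
  forall k, k%:R * w k ^+ 2 <= c <= (k%:R + 2^-1) * w k ^+ 2.
Proof.
pose u k := k%:R * w k ^+ 2; pose v k := (k%:R + 2^-1) * w k ^+ 2.
have um : {homo u : i j / (i <= j)%N >-> i <= j}.
  by apply: homo_leq => // [x|i]; [exact: le_trans|exact: wallis_sqr_lower_step].
have vm : {homo v : i j / (i <= j)%N >-> j <= i}.
  apply: homo_leq => // [y x z xy yz|i]; first exact: le_trans yz xy.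
  exact: wallis_sqr_upper_step.
have uv i j : u i <= v j.
  apply: le_trans (um _ _ (leq_maxl i j)) _; apply: le_trans (vm _ _ (leq_maxr i j)).
  by rewrite /u /v ler_wpM2r ?sqr_ge0 // lerDl invr_ge0.
have w0 : w 0 = 1 by rewrite /wallis big_ord0.
have hU : has_ubound (range u) by exists (v 0%N) => _ [k _ <-].
have ule k : u k <= sup (range u) by apply: ub_le_sup => //; exists k.
have uge k : sup (range u) <= v k.
  by apply: ge_sup; [exists (u 0%N), 0%N|move=> _ [i _ <-]].
exists (sup (range u)).
  apply/andP; split; last first.
    by have := uge 0%N; rewrite /v w0 expr1n mulr1 add0r.
  apply: lt_le_trans (ule 1%N); rewrite /u mul1r exprn_gt0 // wallis_gt0 //.
by move=> k; rewrite ule uge.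
Qed.

(** Because [|x - y| <= x + y], the square of [x - y] is at most [|x ^+ 2 - y ^+ 2|]. *)
Lemma normr_sub_le_sqrt (x y e : R) : 0 <= x -> 0 <= y ->
  `|x ^+ 2 - y ^+ 2| <= e -> `|x - y| <= Num.sqrt e.
Proof.
move=> x0 y0 h; rewrite -(@ler_sqr _) ?nnegrE ?sqrtr_ge0 // sqr_sqrtr; last first.
  exact: le_trans h.
apply: le_trans h; rewrite subr_sqr normrM expr2 ler_wpM2l //.
by rewrite ler_norml; have := ler_norm (x + y); lra.
Qed.

Definition position_pr (n r : nat) : R :=
  (4 * r%:R + 1) * (n%:R - r%:R) * w r ^+ 2 * w (n - r) / w (n + r) / (n ^ 2)%:R.

(** The probability is [A * Q / n ^ 2], with [A] close to [4 * c] and [Q] close to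
    [s = sqrt (n ^ 2 - r ^ 2)]. *)
Lemma position_pr_estimate c n r :
  0 < c <= 2^-1 ->
  (forall k, k%:R * w k ^+ 2 <= c <= (k%:R + 2^-1) * w k ^+ 2) -> (r < n)%N ->
  `|position_pr n r - 4 * c * (f (r%:R / n%:R) / n%:R)| <=
  2 / n%:R * (r.+1%:R)^-1 + 2 / n%:R * (Num.sqrt n%:R)^-1.
Proof.
move=> /andP[c0 c1] wc rn.
have r0 : 0 <= r%:R :> R by rewrite ler0n.
have rn' : r%:R + 1 <= n%:R :> R by rewrite natr1 ler_nat.
have n0 : 0 < n%:R :> R by lra.
pose A := (4 * r%:R + 1) * w r ^+ 2.
pose Q := (n%:R - r%:R) * w (n - r) / w (n + r).
pose s := Num.sqrt (n%:R ^+ 2 - r%:R ^+ 2) : R.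
have s0 : 0 <= s by exact: sqrtr_ge0.
have s2 : s ^+ 2 = n%:R ^+ 2 - r%:R ^+ 2 by rewrite sqr_sqrtr //; nra.
have pE : position_pr n r = A * Q / n%:R ^+ 2.
  by rewrite /position_pr /A /Q natrX; ring.
have fE : f (r%:R / n%:R) / n%:R = s / n%:R ^+ 2.
  rewrite /f /s.
  have -> : n%:R ^+ 2 - r%:R ^+ 2 = n%:R ^+ 2 * (1 - (r%:R / n%:R) ^+ 2) :> R.
    by field; rewrite gt_eqF.
  rewrite sqrtrM ?sqr_ge0 // sqrtr_sqr gtr0_norm //.
  by field; rewrite gt_eqF.
have w2_ge0 k : 0 <= w k ^+ 2 by exact: sqr_ge0.
(* The bounds on [c] put [A] within [w r ^+ 2] of [4 * c]. *)
have AB : `|A - 4 * c| <= (r.+1%:R)^-1.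
  apply: (@le_trans _ _ (w r ^+ 2)).
    have /andP[h1 h2] := wc r; rewrite ler_norml /A; lra.
  have := wallis_sqr_le r; have := w2_ge0 r; rewrite -(natr1 r) => h1 h2.
  rewrite -[leRHS]mul1r ler_pdivlMr; last by lra.
  have := mulr_ge0 r0 h1; lra.
(* The unknown [c] cancels in the ratio of the squares of [w (n - r)] and [w (n + r)]. *)
have [Q0 Q2l Q2u] : [/\ 0 <= Q, n%:R ^+ 2 - r%:R ^+ 2 - n%:R <= Q ^+ 2 &
    Q ^+ 2 <= n%:R ^+ 2 - r%:R ^+ 2 + n%:R].
  have w2_gt0 k : 0 < w k ^+ 2 by rewrite exprn_gt0 // wallis_gt0.
  have q_gt0 : 0 < w (n - r) ^+ 2 / w (n + r) ^+ 2 by exact: divr_gt0.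
  have /andP[a1 a2] := wc (n - r)%N; have /andP[b1 b2] := wc (n + r)%N.
  rewrite natrB ?(ltnW rn) // in a1 a2; rewrite natrD in b1 b2.
  have QE : Q ^+ 2 = (n%:R - r%:R) ^+ 2 * (w (n - r) ^+ 2 / w (n + r) ^+ 2).
    by rewrite /Q !exprMn exprVn -mulrA.
  have h1 : (n%:R - r%:R) * (w (n - r) ^+ 2 / w (n + r) ^+ 2) <=
      n%:R + r%:R + 2^-1.
    by rewrite mulrA ler_pdivrMr //; exact: le_trans a1 b2.
  have h2 : n%:R + r%:R <=
      (n%:R - r%:R + 2^-1) * (w (n - r) ^+ 2 / w (n + r) ^+ 2).
    by rewrite mulrA ler_pdivlMr //; exact: le_trans b1 a2.
  rewrite QE; move: (_ / _) q_gt0 h1 h2 => q q0 h1 h2; split.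
  - by rewrite /Q divr_ge0 ?mulr_ge0 ?(ltW (wallis_gt0 _ _)) //; lra.
  - nra.
  - nra.
have QB : `|Q - s| <= Num.sqrt n%:R.
  by apply: normr_sub_le_sqrt => //; rewrite s2 ler_norml; lra.
have Q2n : Q <= 2 * n%:R by nra.
rewrite pE fE.
have -> : A * Q / n%:R ^+ 2 - 4 * c * (s / n%:R ^+ 2) =
    ((A - 4 * c) * Q + 4 * c * (Q - s)) / n%:R ^+ 2 by field; rewrite gt_eqF.
rewrite normrM [X in _ * X]ger0_norm ?invr_ge0 ?sqr_ge0 //.
have rt0 : 0 < Num.sqrt n%:R :> R by rewrite sqrtr_gt0.
have rt2 : Num.sqrt n%:R ^+ 2 = n%:R :> R by rewrite sqr_sqrtr // ltW.
rewrite ler_pdivrMr ?exprn_gt0 //.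
have -> : (2 / n%:R * r.+1%:R^-1 + 2 / n%:R * (Num.sqrt n%:R)^-1) * n%:R ^+ 2 =
    r.+1%:R^-1 * (2 * n%:R) + 2 * Num.sqrt n%:R :> R.
  move: (Num.sqrt n%:R) rt0 rt2 => t t0 <-; rewrite -(natr1 r).
  by field; neq0_lra.
apply: le_trans (ler_normD _ _) _; apply: lerD; rewrite normrM.
  by rewrite (ger0_norm Q0) ler_pM.
by rewrite ger0_norm ?ler_pM //; lra.
Qed.

(** A crude harmonic bound, matched to the other error of order [1 / sqrt n]; the sum telescopes
    against [2 * sqrt]. *)
Lemma sum_inv_le (n : nat) : \sum_(r < n) (r.+1%:R)^-1 <= 2 * Num.sqrt n%:R :> R.
Proof.
elim: n => [|n IHn]; first by rewrite big_ord0 mulr_ge0.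
rewrite big_ord_recr /=; apply: le_trans (lerD IHn (lexx _)) _.
have n0 : 0 <= n%:R :> R by rewrite ler0n.
rewrite -(natr1 n); set m := n%:R in n0 *.
have a0 := sqrtr_ge0 m; have a2 := sqr_sqrtr n0.
have b0 : 1 <= Num.sqrt (m + 1) by rewrite -[leLHS]sqrtr1 ler_wsqrtr //; lra.
have b2 : Num.sqrt (m + 1) ^+ 2 = m + 1 by rewrite sqr_sqrtr //; lra.
have -> : (m + 1)^-1 = (Num.sqrt (m + 1) ^+ 2)^-1 by rewrite b2.
move: (Num.sqrt m) (Num.sqrt (m + 1)) a0 a2 b0 b2 => x y x0 x2 y1 y2.
have xy : x <= y by rewrite -ler_sqr ?nnegrE; lra.
(* As [y ^+ 2 - x ^+ 2 = 1], the right side is [1 + (y - x) ^+ 2]. *)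
have h : 1 <= 2 * y * (y - x) by have := sqr_ge0 (y - x); lra.
rewrite -subr_ge0.
have -> : 2 * y - (2 * x + (y ^+ 2)^-1) = (2 * (y - x) * y ^+ 2 - 1) / y ^+ 2.
  by field; neq0_lra.
apply: divr_ge0; last by rewrite sqr_ge0.
have := mulr_ge0 (_ : 0 <= y - 1) (_ : 0 <= 2 * y * (y - x)).
by move=> /(_ ltac:(lra) ltac:(lra)); lra.
Qed.
End Estimates.

(** * Distribution functions and the limit *)

Section Limit.
Variable R : realType.
Local Notation f := (@semicircle R).
Local Notation G := (@semicircle_primitive R).
Local Notation p := (position_pr R).

Lemma semicircle_riemann_sum (n j : nat) : (0 < n)%N -> (j <= n)%N ->
  `|\sum_(r < j) f (r%:R / n%:R) / n%:R - G (j%:R / n%:R)| <= n%:R^-1.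
Proof.
move=> n_gt0; have n0 : 0 < n%:R :> R by rewrite ltr0n.
have f1 (x : R) : 0 <= f x <= 1 by rewrite semicircle_ge0 semicircle_le1.
(* Left sums of a decreasing function overestimate, and the excess telescopes to this bound. *)
suff H : (j <= n)%N ->
    0 <= \sum_(r < j) f (r%:R / n%:R) / n%:R - G (j%:R / n%:R) <=
    (f 0 - f (j%:R / n%:R)) / n%:R.
  move=> /H /andP[h1 h2]; rewrite ger0_norm //; apply: le_trans h2 _.
  rewrite -[leRHS]mul1r ler_wpM2r ?invr_ge0 ?ler0n //.
  by have := f1 0; have := f1 (j%:R / n%:R); lra.
elim: j => [|j IHj] jn.
  by rewrite big_ord0 mul0r semicircle_primitive0 !subrr mul0r lexx.
have /andP[h1 h2] := IHj (ltnW jn).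
have x0 : 0 <= j%:R / n%:R :> R by rewrite divr_ge0.
have yE : j.+1%:R / n%:R = j%:R / n%:R + n%:R^-1 :> R.
  by rewrite -(natr1 j) mulrDl mul1r.
have y1 : j.+1%:R / n%:R <= 1 :> R by rewrite ler_pdivrMr // mul1r ler_nat.
have xy : j%:R / n%:R <= j.+1%:R / n%:R :> R by rewrite yE lerDl invr_ge0 ltW.
have /andP[] := semicircle_primitive_incr x0 xy y1.
have -> : j.+1%:R / n%:R - j%:R / n%:R = n%:R^-1 :> R by rewrite yE addrAC subrr add0r.
rewrite big_ord_recr /=; move: h1 h2; rewrite !mulrBl; lra.
Qed.

(** This is [sum_corner_ratio] for the staircase, divided by its [n ^ 2] cells. *)
Lemma sum_position_pr (n : nat) : (0 < n)%N -> \sum_(r < n) p n r = 1.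
Proof.
move=> n0; have := sum_corner_ratio R (@odd_parts_strict n).
rewrite sum_odd_parts (reindex_inj rev_ord_inj) /= => E.
under eq_bigr => r _ do rewrite /position_pr -corner_ratio_odd_parts.
by rewrite -mulr_suml E divff // pnatr_eq0 -lt0n expn_gt0 n0.
Qed.

Section WithConstant.
Variable c : R.
Hypothesis c_bnd : 0 < c <= 2^-1.
Hypothesis c_wallis :
  forall k, k%:R * wallis R k ^+ 2 <= c <= (k%:R + 2^-1) * wallis R k ^+ 2.

(** The constant 8 is 4 from the harmonic sum, 2 from the other pointwise error and 2 from the
    Riemann sum, where [4 * c <= 2]. *)
Lemma position_cdf_estimate (n j : nat) : (0 < n)%N -> (j <= n)%N ->
  `|\sum_(r < j) p n r - 4 * c * G (j%:R / n%:R)| <= 8 / Num.sqrt n%:R.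
Proof.
move=> n_gt0 jn; have n1 : 1 <= n%:R :> R by rewrite ler1n.
have n0 : 0 < n%:R :> R by lra.
have rt1 : 1 <= Num.sqrt n%:R :> R by rewrite -[leLHS]sqrtr1 ler_wsqrtr.
have rt2 : Num.sqrt n%:R ^+ 2 = n%:R :> R by rewrite sqr_sqrtr // ltW.
have h1 : `|\sum_(r < j) (p n r - 4 * c * (f (r%:R / n%:R) / n%:R))| <=
    6 / Num.sqrt n%:R.
  apply: le_trans (ler_norm_sum _ _ _) _.
  apply: (@le_trans _ _ (\sum_(r < n)
     (2 / n%:R * (r.+1%:R)^-1 + 2 / n%:R * (Num.sqrt n%:R)^-1))).
    rewrite (big_ord_widen n (fun r => `|p n r - 4 * c * (f (r%:R / n%:R) / n%:R)|)) //.
    rewrite big_mkcond /=; apply: ler_sum => r _; case: ifP => _.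
      exact: position_pr_estimate.
    by rewrite addr_ge0 ?mulr_ge0 ?invr_ge0 ?sqrtr_ge0 ?ler0n.
  rewrite big_split /= -mulr_sumr sumr_const card_ord -(mulr_natr (_ * _^-1)).
  have -> : 6 / Num.sqrt n%:R = 2 / n%:R * (2 * Num.sqrt n%:R) +
      2 / n%:R * (Num.sqrt n%:R)^-1 * n%:R :> R.
    by move: (Num.sqrt n%:R) rt1 rt2 => t t1 <-; field; neq0_lra.
  rewrite lerD2r ler_wpM2l ?sum_inv_le // divr_ge0 // ltW //.
have h2 := semicircle_riemann_sum n_gt0 jn.
rewrite big_split /= sumrN -mulr_sumr in h1.
set S1 := \sum_(r < j) p n r in h1 *; set S2 := \sum_(r < j) _ in h1 h2.
have -> : S1 - 4 * c * G (j%:R / n%:R) =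
  (S1 - 4 * c * S2) + 4 * c * (S2 - G (j%:R / n%:R)) by ring.
apply: le_trans (ler_normD _ _) _.
have -> : 8 / Num.sqrt n%:R = 6 / Num.sqrt n%:R + 2 / Num.sqrt n%:R :> R.
  by rewrite -mulrDl; congr (_ / _); ring.
have /andP[c0 c1] := c_bnd.
apply: lerD => //; rewrite normrM ger0_norm; last by lra.
apply: (@le_trans _ _ (2 * n%:R^-1)).
  by apply: ler_pM => //; lra.
rewrite ler_pM2l ?ltr0n // lef_pV2 ?posrE //; last by lra.
by rewrite -{2}rt2 expr2 ler_peMr //; lra.
Qed.
End WithConstant.

Lemma cvg_of_inv_sqrt_bound (u : R^nat) (l K : R) :
  (forall n, (0 < n)%N -> `|u n - l| <= K / Num.sqrt n%:R) -> u @ \oo --> l.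
Proof.
move=> H; apply/cvgrPdist_le => e e0; near=> n.
have n0 : (0 < n)%N by near: n; exact: nbhs_infty_gt.
rewrite distrC; apply: le_trans (H n n0) _.
have hn : (K / e) ^+ 2 <= n%:R by near: n; exact: nbhs_infty_ger.
have rt0 : 0 < Num.sqrt n%:R :> R by rewrite sqrtr_gt0 ltr0n.
rewrite ler_pdivrMr // mulrC -ler_pdivrMr //.
apply: le_trans (ler_norm _) _; rewrite -sqrtr_sqr; exact: ler_wsqrtr.
Unshelve. all: by end_near. Qed.

(** At [j = n] the total mass 1 is compared with [4 * c * G 1 = c * pi], so a constant sequence
    converges to [c * pi]. *)
Lemma wallis_constant (c : R) : 0 < c <= 2^-1 ->
  (forall k, k%:R * wallis R k ^+ 2 <= c <= (k%:R + 2^-1) * wallis R k ^+ 2) ->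
  c = pi^-1.
Proof.
move=> c01 wc.
have pi0 := pi_gt0 R.
have H : (fun=> 1 : R) @ \oo --> c * pi.
  apply: (@cvg_of_inv_sqrt_bound _ _ 8) => n n0.
  have := position_cdf_estimate c01 wc n0 (leqnn n).
  rewrite sum_position_pr // divff ?pnatr_eq0 -?lt0n // semicircle_primitive1.
  by congr (`|1 - _| <= _); field.
have cpi : c * pi = 1 by rewrite -(cvg_lim _ H) ?lim_cst.
by apply: (mulIf (lt0r_neq0 pi0)); rewrite cpi mulVf ?gt_eqF.
Qed.

(** Turns a threshold on [r / n] into one on [r], for the strict and the weak inequality at once. *)
Lemma threshold_index (n : nat) (P : pred nat) (b : R) : (0 < n)%N ->
  0 <= b <= 1 ->
  (forall r, P r -> r%:R / n%:R <= b) -> (forall r, ~~ P r -> b <= r%:R / n%:R) ->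
  (forall r s, (r <= s)%N -> P s -> P r) ->
  exists j, [/\ (j <= n)%N, forall r, (r < n)%N -> P r = (r < j)%N &
    b <= j%:R / n%:R <= b + n%:R^-1].
Proof.
move=> n_gt0 /andP[b0 b1] Pb Nb Pm; have n0 : 0 < n%:R :> R by rewrite ltr0n.
(* The alternative [k == n] caps the least failing index at [n], where [b <= 1] replaces the failure
   of [P]. *)
have ex : exists k, (k == n) || ~~ P k by exists n; rewrite eqxx.
case: (ex_minnP ex) => j jP jmin; have jn : (j <= n)%N by rewrite jmin ?eqxx.
exists j; split=> // [r rn|].
  case: ltnP => rj.
    by apply: contraTT rj => NP; rewrite -leqNgt jmin // NP orbT.
  case/orP: jP => [/eqP jE|]; first by rewrite jE leqNgt rn in rj.
  by apply: contraNF; exact: Pm.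
apply/andP; split.
  by case/orP: jP => [/eqP->|/Nb //]; rewrite divff ?gt_eqF.
case: j jP jmin jn => [|j] jP jmin jn.
  by rewrite mul0r addr_ge0 // invr_ge0 ltW.
have Pj : P j by apply: contraT => NP; have := jmin j; rewrite NP orbT ltnn => /(_ isT).
by rewrite -(natr1 j) mulrDl mul1r lerD2r Pb.
Qed.

Lemma position_interval_estimate (n : nat) (a b : R) : (0 < n)%N ->
  0 <= a -> a <= b -> b <= 1 ->
  `|\sum_(r < n | a <= r%:R / n%:R <= b) p n r - 4 / pi * (G b - G a)| <=
  20 / Num.sqrt n%:R.
Proof.
move=> n_gt0 a0 ab b1; have n1 : 1 <= n%:R :> R by rewrite ler1n.
have n0 : 0 < n%:R :> R by lra.
have [c c01 wc] := wallis_sqr_bounds R.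
have cE := wallis_constant c01 wc.
have mono (r s : nat) : (r <= s)%N -> r%:R / n%:R <= s%:R / n%:R :> R.
  by move=> rs; rewrite ler_pM2r ?invr_gt0 // ler_nat.
have [||||jb [jbn jbP jbb]] := @threshold_index n (fun r => r%:R / n%:R <= b) b n_gt0.
- by apply/andP; split; lra.
- by [].
- by move=> r; rewrite -ltNge => /ltW.
- by move=> r s /mono; exact: le_trans.
(* Strict here, so that subtracting the indices below [ja] keeps those with [r / n = a]. *)
have [||||ja [jan jaP jab]] := @threshold_index n (fun r => r%:R / n%:R < a) a n_gt0.
- by apply/andP; split; lra.
- by move=> r /ltW.
- by move=> r; rewrite -leNgt.
- by move=> r s /mono; exact: le_lt_trans.
have -> : \sum_(r < n | a <= r%:R / n%:R <= b) p n r =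
    \sum_(r < jb) p n r - \sum_(r < ja) p n r.
  rewrite (big_ord_widen n (p n) jbn) (big_ord_widen n (p n) jan).
  rewrite [X in _ = X - _](bigID (fun r : 'I_n => (r < ja)%N)) /=.
  rewrite [X in _ = X + _ - _](eq_bigl (fun r : 'I_n => (r < ja)%N)).
    rewrite addrAC subrr add0r; apply: eq_bigl => r.
    by rewrite -jbP // -jaP // -leNgt andbC.
  move=> r; apply: andb_idl; rewrite -jbP // -jaP // => ra.
  by apply: le_trans ab; exact: ltW.
have Eb := position_cdf_estimate c01 wc n_gt0 jbn.
have Ea := position_cdf_estimate c01 wc n_gt0 jan.
have j01 j : (j <= n)%N -> 0 <= (j%:R / n%:R : R) <= 1.
  by move=> jn; rewrite divr_ge0 //= ler_pdivrMr // mul1r ler_nat.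
have Lb : `|G (jb%:R / n%:R) - G b| <= n%:R^-1.
  apply: le_trans (semicircle_primitive_lipschitz _ (j01 _ jbn)) _.
    by apply/andP; split; lra.
  by have /andP[? ?] := jbb; rewrite ger0_norm; lra.
have La : `|G (ja%:R / n%:R) - G a| <= n%:R^-1.
  apply: le_trans (semicircle_primitive_lipschitz _ (j01 _ jan)) _.
    by apply/andP; split; lra.
  by have /andP[? ?] := jab; rewrite ger0_norm; lra.
have nrt : n%:R^-1 <= (Num.sqrt n%:R)^-1 :> R.
  have rt1 : 1 <= Num.sqrt n%:R :> R by rewrite -[leLHS]sqrtr1 ler_wsqrtr.
  rewrite lef_pV2 ?posrE //; last by lra.
  by rewrite -{2}(sqr_sqrtr (ltW n0)) expr2 ler_peMr //; lra.
(* The constant 20 is 8 for each distribution function, plus [4 * c <= 2] times the two rounding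
   errors [1 / n]. *)
rewrite -cE; move: Eb Ea Lb La nrt.
move: (\sum_(r < jb) _) (\sum_(r < ja) _) (G _) (G _) (G b) (G a) => x y gb ga Gb Ga.
move: (n%:R^-1) (Num.sqrt n%:R)^-1 => t u.
rewrite !ler_norml; case/andP: c01 => c0 c1.
move=> /andP[? ?] /andP[? ?] /andP[? ?] /andP[? ?] ?; nra.
Qed.

End Limit.

Theorem theorem1 (R : realType) (a b : R)
    (a_ge0 : 0 <= a) (le_ab : a <= b) (b_le1 : b <= 1) :
  uniform_pr R (SYT (staircase n))
    (fun T => a <= (max_label_pos T)%:R / n%:R <= b) @[n --> \oo] -->
  \int[@lebesgue_measure R]_(x in `[a, b]) (4 / pi * Num.sqrt (1 - x ^+ 2)).
Proof.
rewrite integral_semicircle //.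
(* The law of the position is stated for sizes [n.+1]; size 0 is excluded by the bound's
   hypothesis. *)
apply: (@cvg_of_inv_sqrt_bound _ _ _ 20) => -[//|n] n0.
rewrite /uniform_pr (@uniform_pr_max_label_pos R n
  (fun r => a <= r%:R / n.+1%:R <= b)).
under eq_bigr => r _ do rewrite corner_ratio_odd_parts.
exact: position_interval_estimate.
Qed.
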